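(* Let $q\ne 2$. Then, for every real $p>0$, the Schatten $q$-class $\mathcal{C}_q$ admits a nontrivial $p$-polygonal equality.
   Context: For $0<q<\infty$, the Schatten $q$-class $\mathcal{C}_q$ is the space of compact operators $A$ on the separable infinite-dimensional Hilbert space $\ell_2$ whose singular values $(s_k(A))_k$ satisfy $\|A\|_q=\bigl(\sum_k s_k(A)^q\bigr)^{1/q}<\infty$; $\mathcal{C}_\infty$ is the space of all compact operators on $\ell_2$ with $\|A\|_\infty=\sup_k s_k(A)$, the operator norm. It is regarded as a metric space with its usual metric: $d(A,B)=\|A-B\|_q$ if $q\ge 1$, and $d(A,B)=\|A-B\|_q^q$ if $0<q<1$. (In the case $0<q<1$, using $\|A-B\|_q$ in place of $\|A-B\|_q^q$ in the expressions below only rescales $p$, so it does not affect an assertion made for all $p>0$.) Let $(X,d)$ be a metric space and $p>0$. A signed simplex $Q=[x_i(m_i);y_j(n_j)]_{s,t}$ in $X$ consists of (not necessarily distinct) points $x_1,\dots,x_s,y_1,\dots,y_t\in X$ together with real weights $m_1,\dots,m_s,n_1,\dots,n_t$ satisfying $m_1+\cdots+m_s=n_1+\cdots+n_t$. Its $p$-simplex gap is $$\gamma_p(Q)=\sum_{i=1}^s\sum_{j=1}^t m_in_j\,d(x_i,y_j)^p-\sum_{1\le i_1<i_2\le s}m_{i_1}m_{i_2}\,d(x_{i_1},x_{i_2})^p-\sum_{1\le j_1<j_2\le t}n_{j_1}n_{j_2}\,d(y_{j_1},y_{j_2})^p.$$ A $p$-polygonal equality in $(X,d)$ is an equality $\gamma_p(Q)=0$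 for some signed simplex $Q$ in $X$. A signed simplex $Q$ is nondegenerate if the net weights $\sum_{i: x_i=z}m_i-\sum_{j:y_j=z}n_j$, $z\in X$, are not all zero (equivalently, by merging repeated points, cancelling, and moving negative weights to the other side, $Q$ can be reduced to a signed simplex with all points distinct and all weights strictly positive). A $p$-polygonal equality $\gamma_p(Q)=0$ is nontrivial if $Q$ is nondegenerate. *)

(* Defs.v *)
From HB Require Import structures.
From mathcomp Require Import all_boot all_order all_algebra.
From mathcomp Require Import all_classical all_reals all_analysis.
From mathcomp Require Import complex.

Set Implicit Arguments.
Unset Strict Implicit.
Unset Printing Implicit Defensive.

Import Order.TTheory GRing.Theory Num.Theory.
Import numFieldNormedType.Exports.
Import ComplexField.Normc.

Local Open Scope classical_set_scope.
Local Open Scope ring_scope.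
Local Open Scope complex_scope.

Section SquareSummable.
Context {R : realType}.
Implicit Types (x y : nat -> R[i]^o) (n : nat).

Definition square_summable : set (nat -> R[i]^o) :=
  [set x | cvgn (series (fun n => normc (x n) ^+ 2))].

Definition partial_norm2 x n : R :=
  Num.sqrt (series (fun k => normc (x k) ^+ 2) n).

Definition norm2 x : R := Num.sqrt (limn (series (fun n => normc (x n) ^+ 2))).

Lemma normc_ge0 (z : R[i]) : 0 <= normc z.
Proof. by case: z => a b; exact: sqrtr_ge0. Qed.

Lemma normc_normr (z : R[i]) : `|z| = (normc z)%:C.
Proof. by []. Qed.

Lemma nd_series_sqr x : nondecreasing_seq (series (fun n => normc (x n) ^+ 2)).
Proof.
by apply/nondecreasing_seqP => n; rewrite !seriesEord /= big_ord_recr /= lerDl sqr_ge0.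
Qed.

Lemma series_sqr_ge0 x n : 0 <= series (fun k => normc (x k) ^+ 2) n.
Proof. by rewrite seriesEord; apply: sumr_ge0 => i _; rewrite sqr_ge0. Qed.

Lemma partial_norm2_ge0 x n : 0 <= partial_norm2 x n.
Proof. exact: sqrtr_ge0. Qed.

Lemma sqr_partial_norm2 x n :
  partial_norm2 x n ^+ 2 = series (fun k => normc (x k) ^+ 2) n.
Proof. by rewrite sqr_sqrtr // series_sqr_ge0. Qed.

Lemma partial_norm2D x y n :
  partial_norm2 (x + y) n <= partial_norm2 x n + partial_norm2 y n.
Proof.
elim: n => [|n IHn].
  by rewrite /partial_norm2 !seriesEord /= !big_ord0 sqrtr0 addr0.
have e z : partial_norm2 z n.+1 = normc (partial_norm2 z n +i* normc (z n)).
  by rewrite /= sqr_partial_norm2 /partial_norm2 !seriesEord /= big_ord_recr.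
rewrite !e.
apply: (le_trans _ (le_normcD (partial_norm2 x n +i* normc (x n) : Rcomplex R)
                              (partial_norm2 y n +i* normc (y n)))).
have xyn : normc ((x + y) n) <= normc (x n) + normc (y n).
  exact: (le_normcD (x n : Rcomplex R) (y n)).
rewrite /= ler_wsqrtr // lerD // ler_sqr ?nnegrE ?addr_ge0 ?normc_ge0 //;
  exact: partial_norm2_ge0.
Qed.

Lemma partial_norm2_le x n : square_summable x -> partial_norm2 x n <= norm2 x.
Proof.
by move=> sx; rewrite ler_wsqrtr //; exact: nondecreasing_cvgn_le (nd_series_sqr x) sx n.
Qed.

Lemma square_summable_le x (M : R) :
  (forall n, partial_norm2 x n <= M) -> square_summable x /\ norm2 x <= M.
Proof.
move=> xM; have M0 : 0 <= M := le_trans (partial_norm2_ge0 x 0) (xM 0).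
have h n : series (fun k => normc (x k) ^+ 2) n <= M ^+ 2.
  by rewrite -sqr_partial_norm2 ler_sqr ?nnegrE ?partial_norm2_ge0.
have sx : square_summable x.
  apply: nondecreasing_is_cvgn; first exact: nd_series_sqr.
  by exists (M ^+ 2) => _ [n _ <-].
split => //; rewrite -[leRHS](ger0_norm M0) -sqrtr_sqr ler_wsqrtr //.
by apply: limr_le => //; exact: nearW.
Qed.

Lemma norm2D x y : square_summable x -> square_summable y ->
  square_summable (x + y) /\ norm2 (x + y) <= norm2 x + norm2 y.
Proof.
move=> sx sy; apply: square_summable_le => n.
by rewrite (le_trans (partial_norm2D x y n)) // lerD ?partial_norm2_le.
Qed.

Lemma norm2Z (a : R[i]) x : square_summable x ->
  square_summable (a *: x) /\ norm2 (a *: x) = normc a * norm2 x.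
Proof.
move=> sx.
have -> : norm2 (a *: x) = Num.sqrt (limn (normc a ^+ 2 *: series (fun n => normc (x n) ^+ 2))).
  congr (Num.sqrt (limn _)); apply/funext => n.
  rewrite !seriesEord /= /GRing.scale /= scaler_sumr; apply: eq_bigr => i _.
  by rewrite normcM exprMn.
split.
  rewrite /square_summable /=.
  rewrite (_ : series _ = normc a ^+ 2 *: series (fun n => normc (x n) ^+ 2)).
    exact: is_cvgZl_tmp.
  apply/funext => n.
  rewrite !seriesEord /= /GRing.scale /= scaler_sumr; apply: eq_bigr => i _.
  by rewrite normcM exprMn.
by rewrite limZl_tmp // sqrtrM ?sqr_ge0 // sqrtr_sqr ger0_norm ?normc_ge0.
Qed.

Lemma norm2_eq0 x : square_summable x -> norm2 x = 0 -> x = 0.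
Proof.
move=> sx x0; apply/funext => n; apply: eq0_normc.
have := partial_norm2_le n.+1 sx; rewrite x0 => p0.
have : partial_norm2 x n.+1 ^+ 2 = 0.
  by apply/eqP; rewrite sqrf_eq0 eq_le p0 partial_norm2_ge0.
rewrite sqr_partial_norm2 seriesEord /= big_ord_recr /= => /eqP.
rewrite paddr_eq0 ?sqr_ge0 //; last by apply: sumr_ge0 => i _; rewrite sqr_ge0.
by rewrite sqrf_eq0 => /andP[_ /eqP].
Qed.

Definition ell2_pred : {pred (nat -> R[i]^o)} :=
  fun x => `[< square_summable x >].

Lemma ell2_submod_closed : submod_closed ell2_pred.
Proof.
split.
  apply/asboolP; have [] // := @square_summable_le 0 0 => n.
  rewrite /partial_norm2 seriesEord /= big1 ?sqrtr0 // => i _.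
  by rewrite [X in X ^+ 2](normc0 R) expr0n.
move=> a x y /asboolP sx /asboolP sy; apply/asboolP.
by apply: (norm2D _ sy).1; exact: (norm2Z a sx).1.
Qed.

End SquareSummable.

HB.instance Definition _ (R : realType) :=
  GRing.isSubmodClosed.Build R[i] (nat -> R[i]^o)
    (@ell2_pred R) ell2_submod_closed.

Record ell2 (R : realType) := Ell2 {
  ell2_seq :> nat -> R[i]^o;
  _ : ell2_seq \in @ell2_pred R }.

Section Ell2.
Context {R : realType}.

HB.instance Definition _ := [isSub of ell2 R for @ell2_seq R].
HB.instance Definition _ := [Choice of ell2 R by <:].
HB.instance Definition _ := [SubChoice_isSubLmodule of ell2 R by <:].

Implicit Types x y : ell2 R.

Lemma ell2_summable x : square_summable x.
Proof. by apply/asboolP; exact: (valP x). Qed.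

Lemma ell2_seqD x y : ell2_seq (x + y) = ell2_seq x + ell2_seq y.
Proof. exact: (raddfD (val : ell2 R -> (nat -> R[i]^o))). Qed.

Lemma ell2_seqZ (a : R[i]) x : ell2_seq (a *: x) = a *: ell2_seq x.
Proof. by []. Qed.

(* The norm of a normedModType over R[i] takes its values in R[i]. *)
Definition ell2_norm x : R[i] := (norm2 x)%:C.

Lemma ell2_normD x y : ell2_norm (x + y) <= ell2_norm x + ell2_norm y.
Proof.
rewrite /ell2_norm -rmorphD lecR ell2_seqD.
exact: (norm2D (@ell2_summable x) (@ell2_summable y)).2.
Qed.

Lemma ell2_normZ (a : R[i]) x : ell2_norm (a *: x) = `|a| * ell2_norm x.
Proof.
rewrite /ell2_norm normc_normr -rmorphM ell2_seqZ; congr (_%:C).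
exact: (norm2Z a (@ell2_summable x)).2.
Qed.

Lemma ell2_norm_eq0 x : ell2_norm x = 0 -> x = 0.
Proof.
by move=> [x0]; apply: val_inj; exact: norm2_eq0 (@ell2_summable x) x0.
Qed.

HB.instance Definition _ :=
  Lmodule_isNormed.Build R[i] (ell2 R) ell2_normD ell2_normZ ell2_norm_eq0.

End Ell2.

Section Operators.
Context {R : realType}.
Implicit Types (x y : ell2 R) (A : ell2 R -> ell2 R).

Definition inner x y : R[i] :=
  limn (series (fun n => x n * (y n)^*) : nat -> R[i]^o).

Definition compact_operator A : Prop :=
  linear A /\ precompact (A @` [set x | `|x| <= 1]).

(* A chosen B with <A x, y> = <x, B y> for all x and y; it exists and is unique
   as soon as A is linear and bounded. *)
Definition adjoint A : ell2 R -> ell2 R :=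
  xget 0 [set B | forall x y, inner (A x) y = inner x (B y)].

Definition op_eigenspace A (c : R[i]) : set (ell2 R) := [set x | A x = c *: x].

Definition has_dim (E : set (ell2 R)) (d : nat) : Prop :=
  exists b : 'I_d -> ell2 R,
    (forall a : 'I_d -> R[i], \sum_i a i *: b i = 0 -> forall i, a i = 0) /\
    E = [set \sum_i a i *: b i | a in [set: 'I_d -> R[i]]].

(* s lists the eigenvalues of |A| = (A^* A)^(1/2), i.e. the square roots of the
   eigenvalues of A^* A, in nonincreasing order and repeated according to
   multiplicity. The value 0 serves as padding when A has finite rank, and is
   not counted otherwise, so multiplicities are only prescribed for l > 0. For
   compact A there is exactly one such s. *)
Definition is_singular_values A (s : nat -> R) : Prop :=
  [/\ forall k, 0 <= s k,
      nonincreasing_seq s &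
      forall l : R, 0 < l -> exists d : nat,
        has_dim (op_eigenspace (adjoint A \o A) (l ^+ 2)%:C) d /\
        ([set k | s k = l] #= `I_d)%card].

Definition singular_values A : nat -> R := xget 0 (is_singular_values A).

(* ||A||_q for 0 < q <= +oo, with value +oo when the series diverges; the last
   branch is the case q = +oo. *)
Definition schatten_enorm (q : \bar R) A : \bar R :=
  match q with
  | r%:E => (\sum_(0 <= k <oo) (singular_values A k `^ r)%:E) `^ r^-1
  | _ => ereal_sup (range (fun k => (singular_values A k)%:E))
  end%E.

Definition schatten_class (q : \bar R) : set (ell2 R -> ell2 R) :=
  [set A | compact_operator A /\ (schatten_enorm q A < +oo)%E].

Definition schatten_norm (q : \bar R) A : R := fine (schatten_enorm q A).

Definition schatten_dist (q : \bar R) (A B : schatten_class q) : R :=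
  if (1 <= q)%E then schatten_norm q (val A - val B)
  else schatten_norm q (val A - val B) `^ fine q.

End Operators.

(* The definitions below make sense for an arbitrary function d : X -> X -> R;
   they are meant for the distance d of a metric space X. *)
Record signed_simplex (R : realType) (X : Type) := SignedSimplex {
  xsize : nat;
  ysize : nat;
  xpt : 'I_xsize -> X;
  xwt : 'I_xsize -> R;
  ypt : 'I_ysize -> X;
  ywt : 'I_ysize -> R;
  xsize_gt0 : (0 < xsize)%N;
  ysize_gt0 : (0 < ysize)%N;
  balanced : \sum_i xwt i = \sum_j ywt j }.

Arguments xpt {R X} _ _.
Arguments xwt {R X} _ _.
Arguments ypt {R X} _ _.
Arguments ywt {R X} _ _.

Definition simplex_gap (R : realType) (X : Type) (d : X -> X -> R) (p : R)
    (Q : signed_simplex R X) : R :=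
  \sum_(i < xsize Q) \sum_(j < ysize Q) xwt Q i * ywt Q j * d (xpt Q i) (ypt Q j) `^ p
  - \sum_(i1 < xsize Q) \sum_(i2 < xsize Q | (i1 < i2)%N)
      xwt Q i1 * xwt Q i2 * d (xpt Q i1) (xpt Q i2) `^ p
  - \sum_(j1 < ysize Q) \sum_(j2 < ysize Q | (j1 < j2)%N)
      ywt Q j1 * ywt Q j2 * d (ypt Q j1) (ypt Q j2) `^ p.

Definition net_weight (R : realType) (X : eqType) (Q : signed_simplex R X)
    (z : X) : R :=
  \sum_(i | xpt Q i == z) xwt Q i - \sum_(j | ypt Q j == z) ywt Q j.

Definition nondegenerate (R : realType) (X : eqType)
    (Q : signed_simplex R X) : Prop :=
  exists z, net_weight Q z != 0.

Definition polygonal_equality (R : realType) (X : Type) (d : X -> X -> R)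
    (p : R) (Q : signed_simplex R X) : Prop :=
  simplex_gap d p Q = 0.

Definition nontrivial_polygonal_equality (R : realType) (X : eqType)
    (d : X -> X -> R) (p : R) (Q : signed_simplex R X) : Prop :=
  polygonal_equality d p Q /\ nondegenerate Q.

(* Main.v *)
Require Import Defs.
From HB Require Import structures.
From mathcomp Require Import all_boot all_order all_algebra.
From mathcomp Require Import all_classical all_reals all_analysis.
From mathcomp Require Import complex ring lra.

(** The distance between two involutions depends on whether they commute. Let u
    and v be symmetric involutive real matrices of size m. If they anticommute,
    then (u - v)^2 = 2, so u - v has the singular value 2^(1/2) with multiplicity
    m, and its Schatten norm is m^(1/q) 2^(1/2). If they commute and u v has trace
    0, then (u - v)^2 is 4 times a projection of rank m / 2, and the norm is
    (m / 2)^(1/q) 2 = m^(1/q) 2^(1 - 1/q) (schatten_enorm_sub_involutions). The two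
    norms coincide only for q = 2: commuting involutions are further apart than
    anticommuting ones when q > 2, and closer when q < 2.

    By tensoring with Pauli matrices one finds, in some dimension m, any finite
    number of symmetric involutions with any prescribed pattern of commutation and
    anticommutation, and with all products of two of them of trace 0
    (exists_symmetric_involution_family). Take two families of N
    involutions such that, for q > 2, members of the same family commute and
    members of different families anticommute, and the reverse for q < 2. Then the
    p-th power W of the distance inside each family exceeds the p-th power V of the
    distance between the families, and W / V does not depend on m, hence not on
    N. With weight 1 everywhere the gap is N^2 V - N (N - 1) W, which is negative
    for N large. Moving weight between two points of the first family adds a
    positive multiple of the square of the amount moved, so some choice makes the
    gap vanish (two_cliques_polygonal_equality).

    The matrices act on the first m coordinates of l^2. The singular values of such
    an operator are computed from the eigenspaces of its square, when this square is
    a multiple of a projection (singular_values_mxop), and the operator is compact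
    because the image of the unit ball is parametrized by a bounded set in a
    finite-dimensional space (compact_operator_mxop). *)

Set Implicit Arguments.
Unset Strict Implicit.
Unset Printing Implicit Defensive.

Import Order.TTheory GRing.Theory Num.Theory.
Import numFieldNormedType.Exports.
Import ComplexField.Normc.

Local Open Scope classical_set_scope.
Local Open Scope ring_scope.
Local Open Scope complex_scope.

(** * Involutions with prescribed commutation relations *)

Section InvolutionFamilies.
Variable F : comNzRingType.

(** The Kronecker product of A with a two by two Pauli matrix: sigma_x when b
    holds, and the identity otherwise. *)
Definition tensor_pauli m (b : bool) (A : 'M[F]_m) : 'M[F]_(m + m) :=
  if b then block_mx 0 A A 0 else block_mx A 0 0 A.

(** The Kronecker product of the identity with sigma_z. *)
Definition pauliZ m : 'M[F]_(m + m) := block_mx 1%:M 0 0 (- 1%:M).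

Lemma tensor_pauliM m a b (A B : 'M[F]_m) :
  tensor_pauli a A *m tensor_pauli b B = tensor_pauli (a (+) b) (A *m B).
Proof.
by case: a b => [] []; rewrite /tensor_pauli /= mulmx_block
  !(mulmx0, mul0mx, addr0, add0r).
Qed.

Lemma tensor_pauliZ m b (c : F) (A : 'M[F]_m) :
  tensor_pauli b (c *: A) = c *: tensor_pauli b A.
Proof. by case: b; rewrite /tensor_pauli scale_block_mx scaler0. Qed.

Lemma trmx_tensor_pauli m b (A : 'M[F]_m) :
  (tensor_pauli b A)^T = tensor_pauli b A^T.
Proof. by case: b; rewrite /tensor_pauli tr_block_mx trmx0. Qed.

Lemma mxtrace_tensor_pauli m b (A : 'M[F]_m) :
  \tr A = 0 -> \tr (tensor_pauli b A) = 0.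
Proof. by case: b => trA; rewrite mxtrace_block ?mxtrace0 ?trA addr0. Qed.

Lemma trmx_pauliZ m : (pauliZ m)^T = pauliZ m.
Proof. by rewrite tr_block_mx !trmx0 linearN /= !trmx1. Qed.

Lemma pauliZ_involution m : pauliZ m *m pauliZ m = 1%:M.
Proof.
by rewrite mulmx_block !(mulmx0, mul0mx, addr0, add0r) mulmxN mulNmx opprK !mul1mx
  -scalar_mx_block.
Qed.

(** sigma_z commutes with the identity and anticommutes with sigma_x, so b
    chooses how the new involution relates to an old one. *)
Lemma pauliZ_tensor m b (A : 'M[F]_m) :
  pauliZ m *m tensor_pauli b A = (-1) ^+ b *: (tensor_pauli b A *m pauliZ m).
Proof.
case: b; rewrite /tensor_pauli /= !mulmx_block !(mulmx0, mul0mx, addr0, add0r)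
  !mulNmx !mulmxN !mulmx1 !mul1mx scale_block_mx ?expr1 ?expr0 !(scale1r, scaler0) //.
by rewrite scaleN1r opprK scaleN1r.
Qed.

(** The two diagonal blocks of the product cancel, whatever A is. *)
Lemma mxtrace_pauliZ_tensor m b (A : 'M[F]_m) :
  \tr (tensor_pauli b A *m pauliZ m) = 0.
Proof.
case: b; rewrite /tensor_pauli mulmx_block !(mulmx0, mul0mx, addr0, add0r)
  mxtrace_block ?mxtrace0 ?addr0 //.
by rewrite mulmxN !mulmx1 linearN /= addrN.
Qed.

(** The value true of s i j prescribes that g i and g j anticommute, and false
    that they commute. The trace condition makes the two eigenvalues of a
    commuting product g i *m g j equally frequent. *)
Definition symmetric_involution_family m n (s : nat -> nat -> bool)
    (g : nat -> 'M[F]_m) : Prop :=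
  [/\ forall i, (i < n)%N -> (g i)^T = g i,
      forall i, (i < n)%N -> g i *m g i = 1%:M,
      forall i j, (i < j < n)%N -> g i *m g j = (-1) ^+ s i j *: (g j *m g i) &
      forall i j, (i < j < n)%N -> \tr (g i *m g j) = 0].

(** By induction on n: the old involutions are tensored with the identity or
    with sigma_x according to the relation that they must have with the new
    one, which is 1 (x) sigma_z. The second tensor factors of the old
    involutions commute with each other, so the relations among the old ones
    persist. *)
Lemma exists_symmetric_involution_family n s :
  exists m, (0 < m)%N /\
    exists g : nat -> 'M[F]_m, symmetric_involution_family n s g.
Proof.
elim: n => [|n [m [m0 [g [gT g2 gC gtr]]]]].
  by exists 1%N; split=> //; exists (fun=> 0); split=> // i j /andP[].
exists (m + m)%N; split; first by rewrite addn_gt0 m0.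
exists (fun i => if (i < n)%N then tensor_pauli (s i n) (g i) else pauliZ m).
have sP b : (-1) ^+ b * (-1) ^+ b = 1 :> F by rewrite -exprMn mulrNN mulr1 expr1n.
split=> [i|i|i j|i j]; rewrite ?ltnS.
- case: ltnP => ilt _; last exact: trmx_pauliZ.
  by rewrite trmx_tensor_pauli gT.
- case: ltnP => ilt _; last exact: pauliZ_involution.
  by rewrite tensor_pauliM addbb g2 // /tensor_pauli -scalar_mx_block.
- move=> /andP[ij jn]; rewrite (leq_trans ij jn).
  case: ltnP => jlt.
    by rewrite !tensor_pauliM addbC gC ?ij // tensor_pauliZ.
  have -> : j = n by apply/eqP; rewrite eqn_leq jn.
  by rewrite pauliZ_tensor scalerA sP scale1r.
- move=> /andP[ij jn]; rewrite (leq_trans ij jn).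
  case: ltnP => jlt; last exact: mxtrace_pauliZ_tensor.
  by rewrite tensor_pauliM mxtrace_tensor_pauli // gtr // ij.
Qed.

End InvolutionFamilies.

(** * Projections and differences of involutions *)

Section Projections.
Variable F : numFieldType.

(** S and T come from the full-rank factorization of P; cancelling S on the left
    and T on the right of S T S T = S T gives T S = 1. *)
Lemma idempotent_split m (P : 'M[F]_m) : P *m P = P ->
  exists r (S : 'M[F]_(m, r)) (T : 'M[F]_(r, m)),
    [/\ P = S *m T, T *m S = 1%:M & \tr P = r%:R].
Proof.
move=> PP; set S := col_base P; set T := row_base P.
have TS : T *m S = 1%:M.
  (* Both sides become P when multiplied by S on the left and T on the right. *)
  apply: (row_full_inj (col_base_full P)); apply: (row_free_inj (row_base_free P)).
  by rewrite mulmx1 -/S -/T mulmxA -[S *m T *m S *m T]mulmxA /S /T mulmx_base.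
exists (\rank P), S, T; split=> //; first by rewrite /S /T mulmx_base.
by rewrite -{1}(mulmx_base P) mxtrace_mulC -/S -/T TS mxtrace1.
Qed.

(** A projection of rank r is presented by a factorization S *m T through
    dimension r with T *m S = 1, as the columns of S then form a basis of its
    range. *)
Definition square_is_multiple_of_projection m (A : 'M[F]_m) (c : F) r : Prop :=
  exists (S : 'M[F]_(m, r)) (T : 'M[F]_(r, m)),
    A *m A = c *: (S *m T) /\ T *m S = 1%:M.

(** (A - B)^2 = 2 (1 - A B) and A B is an involution, so (1 - A B) / 2 is a
    projection; its trace m / 2 is its rank. *)
Lemma sub_commuting_involutions m (A B : 'M[F]_m) :
  A *m A = 1%:M -> B *m B = 1%:M -> A *m B = B *m A -> \tr (A *m B) = 0 ->
  exists2 r, m = r.*2 & square_is_multiple_of_projection (A - B) 4 r.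
Proof.
move=> A2 B2 AB trAB.
have sq : (A - B) *m (A - B) = 2 *: (1%:M - A *m B).
  rewrite mulmxBl !mulmxBr A2 B2 -AB scalerDr scalerN !scaler_nat !mulr2n.
  by rewrite opprB opprD addrACA.
have AB2 : A *m B *m (A *m B) = 1%:M.
  by rewrite {2}AB mulmxA -[A *m B *m B]mulmxA B2 mulmx1.
have PP : (2^-1 *: (1%:M - A *m B)) *m (2^-1 *: (1%:M - A *m B)) =
          2^-1 *: (1%:M - A *m B).
  rewrite -scalemxAl -scalemxAr scalerA mulmxBl !mulmxBr !mulmx1 mul1mx AB2.
  by rewrite opprB -mulr2n -[(_ - _) *+ 2]scaler_nat scalerA; congr (_ *: _); field.
have [r [S [T [PST TS trP]]]] := idempotent_split PP.
exists r.
  move: trP; rewrite linearZ linearB /= trAB subr0 mxtrace1 => trP.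
  by apply/eqP; rewrite -(eqr_nat F) -muln2 natrM -trP; apply/eqP; field.
by exists S, T; split=> //; rewrite -PST sq scalerA; congr (_ *: _); field.
Qed.

(** The cross terms A B and B A of (A - B)^2 cancel. *)
Lemma sub_anticommuting_involutions m (A B : 'M[F]_m) :
  A *m A = 1%:M -> B *m B = 1%:M -> A *m B = - (B *m A) ->
  square_is_multiple_of_projection (A - B) 2 m.
Proof.
move=> A2 B2 AB; exists 1%:M, 1%:M; split; rewrite mulmx1 //.
by rewrite mulmxBl !mulmxBr A2 B2 AB opprK opprB addrACA addrN addr0 scaler_nat.
Qed.

End Projections.

(** * Finitely supported sequences *)

Section FiniteSupport.
Variable R : realType.
Local Notation C := R[i].

Lemma cvg_series_finite_support (K : numFieldType) (V : normedModType K)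
    (u : nat -> V) m :
  (forall k, (m <= k)%N -> u k = 0) -> series u @ \oo --> \sum_(i < m) u i.
Proof.
move=> u0; apply: cvg_near_cst; near=> n.
have mn : (m <= n)%N by near: n; exact: nbhs_infty_ge.
rewrite seriesEnat /= (big_cat_nat (leq0n m) mn) /= big_mkord [X in _ + X]big1_seq ?addr0 //.
by move=> i /=; rewrite mem_index_iota => /andP[mi _]; exact: u0.
Unshelve. all: by end_near. Qed.

Definition col_seq m (v : 'cV[C]_m) (k : nat) : C^o :=
  oapp (fun i => v i 0) 0 (insub k).

Lemma col_seq_ord m (v : 'cV[C]_m) (i : 'I_m) : col_seq v i = v i 0.
Proof. by rewrite /col_seq valK. Qed.

Lemma col_seq_ge m (v : 'cV[C]_m) k : (m <= k)%N -> col_seq v k = 0.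
Proof. by move=> mk; rewrite /col_seq insubF // ltnNge mk. Qed.

Lemma col_seq_ell2 m (v : 'cV[C]_m) : col_seq v \in @ell2_pred R.
Proof.
apply/asboolP; apply/cvg_ex; eexists.
apply: (@cvg_series_finite_support _ R^o _ m) => k mk.
by rewrite col_seq_ge // [X in X ^+ 2](normc0 R) expr0n.
Qed.

Definition ell2_of_col m (v : 'cV[C]_m) : ell2 R := Ell2 (col_seq_ell2 v).

Definition col_of_ell2 m (x : ell2 R) : 'cV[C]_m := \col_i x i.

Lemma ell2P (x y : ell2 R) : (forall k, x k = y k) -> x = y.
Proof. by move=> xy; apply: val_inj; apply/funext. Qed.

Lemma ell2_of_colK m : cancel (@ell2_of_col m) (@col_of_ell2 m).
Proof. by move=> v; apply/colP => i; rewrite mxE /= col_seq_ord. Qed.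

Lemma ell2_of_col_linear m : linear (@ell2_of_col m).
Proof.
move=> a u v; apply: ell2P => k.
rewrite ell2_seqD ell2_seqZ /=.
rewrite -[RHS]/(a * col_seq u k + col_seq v k).
case: (ltnP k m) => km; last by rewrite !col_seq_ge // mulr0 addr0.
by rewrite -[k]/(val (Ordinal km)) !col_seq_ord !mxE.
Qed.

HB.instance Definition _ m :=
  GRing.isLinear.Build C 'cV[C]_m (ell2 R) *:%R (@ell2_of_col m)
    (@ell2_of_col_linear m).

Lemma col_of_ell2_linear m : linear (@col_of_ell2 m).
Proof. by move=> a x y; apply/colP => i; rewrite !mxE ell2_seqD ell2_seqZ. Qed.

HB.instance Definition _ m :=
  GRing.isLinear.Build C (ell2 R) 'cV[C]_m *:%R (@col_of_ell2 m)
    (@col_of_ell2_linear m).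

Lemma inner_ell2_of_colr m x (v : 'cV[C]_m) :
  inner x (ell2_of_col v) = \sum_(i < m) x i * (v i 0)^*.
Proof.
rewrite /inner; apply: (@cvg_lim C^o); first exact: norm_hausdorff.
under eq_bigr do rewrite -col_seq_ord.
apply: (@cvg_series_finite_support _ C^o (fun n => x n * (col_seq v n)^*) m).
by move=> k mk; rewrite col_seq_ge // [X in _ * X](@conjc0 R) mulr0.
Qed.

Lemma inner_ell2_of_coll m (v : 'cV[C]_m) y :
  inner (ell2_of_col v) y = \sum_(i < m) v i 0 * (y i)^*.
Proof.
rewrite /inner; apply: (@cvg_lim C^o); first exact: norm_hausdorff.
under eq_bigr do rewrite -col_seq_ord.
apply: (@cvg_series_finite_support _ C^o (fun n => col_seq v n * (y n)^*) m).
by move=> k mk; rewrite col_seq_ge // mul0r.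
Qed.

(** Testing against the k-th basis vector recovers the k-th coordinate. *)
Lemma inner_inj (y z : ell2 R) : (forall x, inner x y = inner x z) -> y = z.
Proof.
move=> yz; apply: ell2P => k.
have h w : inner (ell2_of_col (delta_mx (@ord_max k) 0)) w = (w k)^*.
  rewrite inner_ell2_of_coll (bigD1 ord_max) //= mxE !eqxx mul1r big1 ?addr0 //.
  by move=> i /negbTE ik; rewrite mxE ik mul0r.
by apply: (can_inj (@conjcK R)); rewrite -!h yz.
Qed.

End FiniteSupport.

(** * Dimension *)

Section Dimension.
Variable R : realType.
Local Notation C := R[i].

(** Writing each basis in terms of the other gives rectangular matrices M and N
    with M N = 1, which bounds the size of the identity. *)
Lemma has_dim_le (E : set (ell2 R)) d d' :
  has_dim E d -> has_dim E d' -> (d' <= d)%N.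
Proof.
move=> [b [_ Eb]] [b' [free_b' Eb']].
have bE' i : E (b i).
  rewrite Eb; exists (fun j => (j == i)%:R) => //.
  by rewrite (bigD1 i) //= eqxx scale1r big1 ?addr0 // => j /negbTE ->; rewrite scale0r.
have b'E i : E (b' i).
  rewrite Eb'; exists (fun j => (j == i)%:R) => //.
  by rewrite (bigD1 i) //= eqxx scale1r big1 ?addr0 // => j /negbTE ->; rewrite scale0r.
have /choice[N NE] : forall i, exists a, \sum_j a j *: b' j = b i.
  by move=> i; have := bE' i; rewrite Eb' => -[a _ <-]; exists a.
have /choice[M ME] : forall j, exists a, \sum_i a i *: b i = b' j.
  by move=> j; have := b'E j; rewrite Eb => -[a _ <-]; exists a.
suff MN1 : (\matrix_(j, i) M j i : 'M[C]_(d', d)) *m (\matrix_(i, j) N i j) = 1%:M.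
  exact: mulmx1_min MN1.
apply/matrixP => j k; rewrite !mxE.
have S0 : \sum_l (\sum_i M j i * N i l - (j == l)%:R) *: b' l = 0.
  under eq_bigr do rewrite scalerBl.
  rewrite sumrB [X in _ - X](bigD1 j) //= eqxx scale1r [X in _ - (_ + X)]big1.
    rewrite addr0 -[X in _ - X]ME; apply/eqP; rewrite subr_eq0; apply/eqP.
    under eq_bigr do rewrite scaler_suml.
    rewrite exchange_big /=; apply: eq_bigr => i _.
    by rewrite -NE scaler_sumr; apply: eq_bigr => l _; rewrite scalerA.
  by move=> l; rewrite eq_sym => /negbTE ->; rewrite scale0r.
apply/eqP; rewrite -subr_eq0; apply/eqP; rewrite -[RHS](free_b' _ S0 k).
by congr (_ - _); apply: eq_bigr => i _; rewrite !mxE.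
Qed.

Lemma has_dim_uniq (E : set (ell2 R)) d d' :
  has_dim E d -> has_dim E d' -> d = d'.
Proof. by move=> h h'; apply/eqP; rewrite eqn_leq !(has_dim_le h, has_dim_le h'). Qed.

End Dimension.

(** * Operators given by matrices *)

Section MatrixOperators.
Variable R : realType.
Local Notation C := R[i].
Local Notation toC := (map_mx (real_complex R)).

(** A acts on the first m coordinates, and the other ones are sent to 0. *)
Definition mxop m (A : 'M[R]_m) (x : ell2 R) : ell2 R :=
  ell2_of_col (toC A *m col_of_ell2 m x).

Lemma mxopB m (A B : 'M[R]_m) : mxop A - mxop B = mxop (A - B).
Proof.
apply/funext => x; rewrite -[LHS]/(mxop A x - mxop B x) /mxop -raddfB -mulmxBl.
by rewrite map_mxB.
Qed.

Lemma mxop_comp m (A B : 'M[R]_m) : mxop A \o mxop B = mxop (A *m B).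
Proof. by apply/funext => x; rewrite /mxop /= ell2_of_colK mulmxA map_mxM. Qed.

Lemma mxop_linear m (A : 'M[R]_m) : linear (mxop A).
Proof. by move=> a x y; rewrite /mxop linearP mulmxDr -scalemxAr linearP. Qed.

Lemma mxop_inj m : injective (@mxop m).
Proof.
move=> A B AB; apply: (@map_mx_inj _ _ (real_complex R)).
apply/matrixP => i j.
have := congr1 (fun f => col_of_ell2 m (f (ell2_of_col (delta_mx j 0)))) AB.
rewrite /mxop !ell2_of_colK -!colE => /colP /(_ i).
by rewrite !mxE.
Qed.

Lemma adjoint_mxop m (A : 'M[R]_m) : adjoint (mxop A) = mxop A^T.
Proof.
have adjA x y : inner (mxop A x) y = inner x (mxop A^T y).
  rewrite inner_ell2_of_coll inner_ell2_of_colr.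
  under eq_bigr do rewrite mxE mulr_suml.
  rewrite exchange_big /=; apply: eq_bigr => j _.
  rewrite [X in _ * X^*]mxE (rmorph_sum (@conjc R)) mulr_sumr; apply: eq_bigr => i _.
  rewrite !mxE (rmorphM (@conjc R)) [X in _ * (X * _)]conjc_real.
  by rewrite mulrCA mulrA.
apply: xget_unique => // B adjB; apply/funext => y; apply: inner_inj => x.
by rewrite -adjB adjA.
Qed.

End MatrixOperators.

(** * Singular values *)

Section SingularValues.
Variable R : realType.
Local Notation C := R[i].
Local Notation toC := (map_mx (real_complex R)).

(** Used to turn the multiplicity of a singular value into its position in a
    nonincreasing sequence. *)
Lemma card_eq_II_initial (S : set nat) r :
  (forall k l, (k <= l)%N -> S l -> S k) -> (S #= `I_r)%card -> S = `I_r.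
Proof.
move=> Sdown Sr; apply/seteqP; split=> k /= Sk; last first.
  apply: contrapT => nSk.
  have /subset_card_le : S `<=` `I_k.
    by move=> l Sl /=; rewrite ltnNge; apply/negP => kl; exact: nSk (Sdown _ _ kl Sl).
  by rewrite (card_le_eql Sr) card_le_II leqNgt Sk.
rewrite ltnNge; apply/negP => rk.
have /subset_card_le : `I_r.+1 `<=` S.
  by move=> l /=; rewrite ltnS => lr; exact: Sdown (leq_trans lr rk) Sk.
by rewrite (card_le_eqr Sr) card_le_II ltnn.
Qed.

Section ProjectionMultiple.
Variables (m r : nat) (A : 'M[R]_m) (sigma : R).
Hypothesis A_sym : A^T = A.
Hypothesis sigma_gt0 : 0 < sigma.
Hypothesis sqA : square_is_multiple_of_projection A (sigma ^+ 2) r.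

Lemma adjoint_mxop_comp : adjoint (mxop A) \o mxop A = mxop (A *m A).
Proof. by rewrite adjoint_mxop A_sym mxop_comp. Qed.

(** The eigenspace is the range of the projection S T, with the columns of S as a
    basis. *)
Lemma has_dim_top_eigenspace :
  has_dim (op_eigenspace (adjoint (mxop A) \o mxop A) (sigma ^+ 2)%:C) r.
Proof.
rewrite adjoint_mxop_comp; have [S [T [-> TS]]] := sqA.
have TSC : toC T *m toC S = 1%:M by rewrite -map_mxM TS map_mx1.
have comb (a : 'I_r -> C) : \sum_i a i *: ell2_of_col (col i (toC S)) =
    ell2_of_col (toC S *m \col_i a i).
  under eq_bigr do rewrite -linearZ /=.
  rewrite -raddf_sum; congr (ell2_of_col _); apply/colP => k.
  by rewrite summxE !mxE; apply: eq_bigr => i _; rewrite !mxE mulrC.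
have s0 : (sigma ^+ 2)%:C != 0 :> C.
  by rewrite (inj_eq (@complexI R) _ 0) expf_neq0 // gt_eqF.
exists (fun i => ell2_of_col (col i (toC S))); split.
  move=> a; rewrite comb => /(congr1 (col_of_ell2 m)).
  rewrite ell2_of_colK raddf0 => /(congr1 (mulmx (toC T))).
  rewrite mulmxA TSC mul1mx mulmx0 => /colP a0 i.
  by have := a0 i; rewrite !mxE.
apply/seteqP; split=> [x | _ [a _ <-]]; rewrite /op_eigenspace /= /mxop.
  rewrite map_mxZ -scalemxAl linearZ /= => /(scalerI s0) xE.
  exists (fun i => (toC T *m col_of_ell2 m x) i 0) => //; rewrite comb -[RHS]xE.
  congr (ell2_of_col _); rewrite map_mxM -mulmxA; congr (_ *m _).
  by apply/colP => i; rewrite mxE.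
rewrite comb ell2_of_colK map_mxZ -scalemxAl linearZ /=; congr (_ *: ell2_of_col _).
by rewrite map_mxM -mulmxA [toC T *m _]mulmxA TSC mul1mx.
Qed.

(** Applying T to l^2 x = sigma^2 S T x gives l^2 T x = sigma^2 T x, hence
    T x = 0 and then x = 0. *)
Lemma has_dim_other_eigenspace l : 0 < l -> l != sigma ->
  has_dim (op_eigenspace (adjoint (mxop A) \o mxop A) (l ^+ 2)%:C) 0.
Proof.
move=> l0 ls; rewrite adjoint_mxop_comp; have [S [T [-> TS]]] := sqA.
have TSC : toC T *m toC S = 1%:M by rewrite -map_mxM TS map_mx1.
exists (fun=> 0); split; first by move=> a _ [].
apply/seteqP; split=> [x | _ [a _ <-]]; rewrite /op_eigenspace /=; last first.
  by rewrite big_ord0 scaler0 /mxop raddf0 mulmx0 raddf0.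
rewrite /mxop map_mxZ -scalemxAl map_mxM -mulmxA linearZ /= => xE.
set t := toC T *m col_of_ell2 m x in xE.
have t0 : t = 0.
  have := congr1 (fun y => toC T *m col_of_ell2 m y) xE.
  rewrite !linearZ /= ell2_of_colK mulmxA TSC mul1mx -/t => tE.
  apply/eqP; have /eqP : ((sigma ^+ 2)%:C - (l ^+ 2)%:C) *: t = 0.
    by rewrite scalerBl tE subrr.
  rewrite scaler_eq0 subr_eq0 (inj_eq (@complexI R)).
  by rewrite eqrXn2 ?ltW // eq_sym (negbTE ls).
move: xE; rewrite t0 mulmx0 raddf0 scaler0 => /esym/eqP.
rewrite scaler_eq0 (inj_eq (@complexI R) _ 0) expf_eq0 gt_eqF //= => /eqP ->.
by exists (fun=> 0) => //; rewrite big_ord0.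
Qed.

(** Uniqueness: the multiplicities force every positive term to equal sigma and
    exactly r terms to be positive, and monotonicity puts these first. *)
Lemma singular_values_mxop :
  singular_values (mxop A) = fun k => if (k < r)%N then sigma else 0.
Proof.
apply: xget_unique; first split=> [k|j k jk|l l0].
- by case: ifP => // _; exact: ltW.
- case: ifP => kr; first by rewrite (leq_ltn_trans jk kr).
  by case: ifP => // _; exact: ltW.
- have [->|ls] := eqVneq l sigma.
    exists r; split; first exact: has_dim_top_eigenspace.
    rewrite (_ : [set k | _] = `I_r) //; apply/seteqP; split=> k /=.
      by case: ifP => // _ s0; move: sigma_gt0; rewrite -s0 ltxx.
    by move=> ->.
  exists 0%N; split; first exact: has_dim_other_eigenspace.
  rewrite (_ : [set k | _] = `I_0) //; apply/seteqP; split=> k //=.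
  case: ifP => _ E; first by rewrite E eqxx in ls.
  by move: l0; rewrite -E ltxx.
move=> s [s_ge0 s_dec s_card]; apply/funext => k.
have s_vals j : 0 < s j -> s j = sigma.
  move=> sj; apply/eqP; apply/negPn/negP => sjs.
  have [d [dimd]] := s_card _ sj.
  rewrite (has_dim_uniq dimd (has_dim_other_eigenspace sj sjs)) II0 card_eq0.
  by move=> /eqP/seteqP[/(_ j erefl)].
have sI : [set k | s k = sigma] = `I_r.
  have [d [dimd]] := s_card _ sigma_gt0.
  rewrite (has_dim_uniq dimd has_dim_top_eigenspace); apply: card_eq_II_initial.
  move=> i j ij sj; apply: s_vals; apply: lt_le_trans (s_dec _ _ ij).
  by rewrite sj.
case: ifPn => kr; first by have : `I_r k by []; rewrite -sI.
apply/eqP; rewrite eq_le s_ge0 andbT leNgt; apply/negP => /s_vals sk.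
by have : [set k | s k = sigma] k by []; rewrite sI /= => kr'; rewrite kr' in kr.
Qed.

End ProjectionMultiple.
End SingularValues.

(** * Compactness *)

Section Compactness.
Variable R : realType.
Local Notation C := R[i].
Local Notation toC := (map_mx (real_complex R)).

Lemma real_complex_continuous : continuous (fun a : R => a%:C : C^o).
Proof.
move=> a; apply/cvgrPdist_lt => e e0.
have [eI eR] : complex.Im e = 0 /\ 0 < complex.Re e.
  by move: e0; rewrite ltcE => /andP[/eqP eI eR]; split.
have /cvgrPdist_lt/(_ _ eR) : (b : R) @[b --> a] --> a by exact: cvg_id.
apply: filterS => b ab; rewrite -rmorphB normc_def /= expr0n addr0 sqrtr_sqr.
by rewrite ltcE /= eI eqxx.
Qed.

(** A compact set of scalars containing the unit disc. *)
Definition complex_square : set C^o :=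
  [set ab.1%:C + 'i * ab.2%:C | ab in `[-1, 1]%classic `*` `[-1, 1]%classic].

Lemma compact_complex_square : compact complex_square.
Proof.
apply: (@continuous_compact (R * R)%type C^o).
  apply: continuous_subspaceT => -[a b].
  apply: (@cvgD _ C^o).
    apply: (@continuous_comp _ _ _ (@fst R R) (fun t => t%:C : C^o)); first exact: cvg_fst.
    exact: real_complex_continuous.
  apply: (@cvgMl_tmp C _ _ _ (fun ab : R * R => ab.2%:C)).
  apply: (@continuous_comp _ _ _ (@snd R R) (fun t => t%:C : C^o)); first exact: cvg_snd.
  exact: real_complex_continuous.
by apply: compact_setX; exact: segment_compact.
Qed.

Lemma unit_ball_coord (x : ell2 R) k : `|x| <= 1 -> complex_square (x k).
Proof.
move=> x1; have {x1} nx1 : norm2 x <= 1 by rewrite -lecR; exact: x1.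
have : normc (x k) ^+ 2 <= 1.
  apply: (@le_trans _ _ (partial_norm2 x k.+1 ^+ 2)).
    rewrite sqr_partial_norm2 seriesEord /= big_ord_recr /= lerDr.
    by apply: sumr_ge0 => i _; rewrite sqr_ge0.
  rewrite expr_le1 ?partial_norm2_ge0 //.
  exact: le_trans (partial_norm2_le _ (@ell2_summable R x)) nx1.
case: (x k) => a b; rewrite /= sqr_sqrtr ?addr_ge0 ?sqr_ge0 // => ab.
exists (a, b); last by rewrite /= [RHS]complexE.
by split; rewrite /= in_itv /=; apply/andP; split; nra.
Qed.

(** The image of the unit ball only depends on the first m coordinates, which
    range over a subset of a compact product of squares. *)
Lemma compact_operator_mxop m (A : 'M[R]_m) : compact_operator (mxop A).
Proof.
split; first exact: mxop_linear.
pose c k := ell2_of_col (toC A *m delta_mx k 0).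
pose f (v : 'rV[C^o]_m) := \sum_k v 0 k *: c k.
pose D := [set v : 'rV[C^o]_m | forall k, complex_square (v 0 k)].
have cK : compact (f @` D).
  apply: continuous_compact; last exact: rV_compact (fun=> compact_complex_square).
  apply: continuous_subspaceT.
  apply: continuous_big => [|k _ v]; first exact: add_continuous.
  apply: cvgZr_tmp; first exact: (nbhs_filter v).
  exact: (@coord_continuous C 1 m 0 k v).
exists (f @` D); last by split=> //; apply: compact_closed => //; exact: norm_hausdorff.
move=> _ [x x1 <-]; exists (\row_k x k); first by move=> k; rewrite mxE; exact: unit_ball_coord.
rewrite /f /mxop; under eq_bigr do rewrite mxE -linearZ /= scalemxAr.
rewrite -raddf_sum -mulmx_sumr; congr (ell2_of_col (_ *m _)).
rewrite [RHS]matrix_sum_delta; apply: eq_bigr => k _.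
by rewrite big_ord1 mxE.
Qed.

End Compactness.

(** * Schatten norms *)

Section SchattenNorm.
Variable R : realType.

(** 1 / q, with 1 / +oo = 0. *)
Definition exponent_inv (q : \bar R) : R := if q is t%:E then t^-1 else 0.

(** Since r^0 = 1, one formula covers the case q = +oo, where r > 0 ensures that
    sigma occurs among the singular values. *)
Lemma schatten_enorm_mxop m (A : 'M[R]_m) (q : \bar R) sigma r :
  (0 < q)%E -> 0 < sigma -> (0 < r)%N -> A^T = A ->
  square_is_multiple_of_projection A (sigma ^+ 2) r ->
  schatten_enorm q (mxop A) = (r%:R `^ exponent_inv q * sigma)%:E.
Proof.
move=> q0 s0 r0 AT sqA; rewrite /schatten_enorm (singular_values_mxop AT s0 sqA).
case: q q0 => [t|_|//]; last first.
  rewrite /= powRr0 mul1r; apply/eqP; rewrite eq_le; apply/andP; split.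
    by apply: ge_ereal_sup => _ [k _ <-]; rewrite lee_fin; case: ifP => // _; exact: ltW.
  by apply: ereal_sup_ubound; exists 0%N => //; rewrite r0.
rewrite lte_fin => t0 /=.
rewrite (_ : limn _ = (r%:R * sigma `^ t)%:E); last first.
  rewrite (nneseries_split 0 r); last by move=> k _; rewrite lee_fin powR_ge0.
  rewrite add0n [X in (_ + X)%E]eseries0 ?adde0; last first.
    by move=> k rk _; rewrite ltnNge rk powR0 // gt_eqF.
  rewrite (eq_big_nat _ _ (F2 := fun=> (sigma `^ t)%:E)); last by move=> k /andP[_ ->].
  by rewrite sumEFin big_const_nat subn0 iter_addr_0 mulr_natl.
rewrite poweR_EFin powRM ?powR_ge0 // -powRrM divff ?gt_eqF // powRr1 //.
exact: ltW.
Qed.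

Lemma mxop_schatten_class m (A : 'M[R]_m) (q : \bar R) :
  (schatten_enorm q (mxop A) < +oo)%E -> mxop A \in schatten_class q.
Proof. by move=> Aq; apply/mem_set; split=> //; exact: compact_operator_mxop. Qed.

End SchattenNorm.

(** * Simplices made of two equidistant families *)

Section TwoCliques.
Variable R : realType.

(** The square of the sum is the sum of squares plus twice the sum over pairs. *)
Lemma sum_lt_pairs n (w : 'I_n -> R) :
  \sum_(i < n) \sum_(j < n | (i < j)%N) w i * w j =
  ((\sum_i w i) ^+ 2 - \sum_i w i ^+ 2) / 2.
Proof.
have -> : (\sum_i w i) ^+ 2 =
    \sum_i w i ^+ 2 + 2 * \sum_(i < n) \sum_(j < n | (i < j)%N) w i * w j.
  rewrite expr2 mulr_suml.
  under eq_bigr => i _.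
    rewrite mulr_sumr (bigD1 i) //= (bigID (fun j : 'I_n => (i < j)%N)) /=.
    over.
  rewrite !big_split /= mulr_natl mulr2n; congr (_ + (_ + _)).
    apply: eq_bigr => i _; apply: eq_bigl => j.
    by rewrite andb_idl // => ij; rewrite -val_eqE gtn_eqF.
  rewrite [RHS](exchange_big_dep xpredT) //=; apply: eq_bigr => i _.
  apply: eq_big => [j|j _]; last exact: mulrC.
  by rewrite -leqNgt -val_eqE ltn_neqAle.
by field.
Qed.

(** With N = n + 2, weights 1 + s, 1 - s, 1, ..., 1 on the points x and 1 on the
    points y, the gap equals N^2 V - N (N - 1) W + s^2 W. At s = 0 the second
    hypothesis makes it nonpositive, so a suitable s makes it vanish. *)
Lemma two_cliques_polygonal_equality (X : eqType) (d : X -> X -> R) (p : R) n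
    (x y : 'I_n.+2 -> X) (V W : R) :
  0 < W -> n.+2%:R * V <= n.+1%:R * W ->
  (forall i j, d (x i) (y j) `^ p = V) ->
  (forall i j : 'I_n.+2, (i < j)%N -> d (x i) (x j) `^ p = W) ->
  (forall i j : 'I_n.+2, (i < j)%N -> d (y i) (y j) `^ p = W) ->
  injective y -> (forall i j, x i != y j) ->
  exists Q : signed_simplex R X, nontrivial_polygonal_equality d p Q.
Proof.
move=> W0 VW dxy dxx dyy y_inj xy.
set N : R := n.+2%:R.
have NE : N = n%:R + 2 by rewrite /N -addn2 natrD.
have N0 : 0 <= N := ler0n _ _.
pose s := Num.sqrt (N * (N - 1) - N ^+ 2 * V / W).
have s2 : W * s ^+ 2 = W * (N * (N - 1)) - N ^+ 2 * V.
  rewrite sqr_sqrtr; first by field; rewrite gt_eqF.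
  rewrite subr_ge0 ler_pdivrMr // expr2 -!mulrA ler_wpM2l //.
  apply: le_trans VW _; rewrite ler_wpM2r ?(ltW W0) // NE -[n.+1%:R]natr1; lra.
(* The perturbation keeps the sum N and raises the sum of squares by 2 s^2. *)
pose w (i : 'I_n.+2) : R := 1 + s * ((i == 0 :> nat)%:R - (i == 1 :> nat)%:R).
have sumw : \sum_i w i = N.
  rewrite big_split /= sumr_const card_ord -mulr_sumr !big_ord_recl /= big1.
    by rewrite /N; ring.
  by move=> i _; rewrite subrr.
have sumw2 : \sum_i w i ^+ 2 = N + 2 * s ^+ 2.
  rewrite !big_ord_recl /= (eq_bigr (fun=> 1)); last first.
    by move=> i _; rewrite /w /= subrr mulr0 addr0 expr1n.
  by rewrite sumr_const card_ord /w /= NE -[1 *+ n]/(n%:R); ring.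
have balanced_w : \sum_i w i = \sum_(j < n.+2) (1 : R).
  by rewrite sumw sumr_const card_ord.
exists (SignedSimplex x y (ltn0Sn _) (ltn0Sn _) balanced_w); split; last first.
  exists (y ord0); rewrite /net_weight /= big1.
    rewrite sub0r oppr_eq0 (eq_bigl (pred1 ord0)) ?big_pred1_eq ?oner_eq0 //.
    by move=> j; rewrite (inj_eq y_inj).
  by move=> i; rewrite (negbTE (xy _ _)).
rewrite /polygonal_equality /simplex_gap /=.
have -> : \sum_i \sum_(j < n.+2) w i * 1 * d (x i) (y j) `^ p = N ^+ 2 * V.
  under eq_bigr do under eq_bigr do rewrite dxy mulr1.
  under eq_bigr do rewrite sumr_const card_ord -mulr_natr.
  by rewrite -!mulr_suml sumw /N; ring.
have pairs (z : 'I_n.+2 -> X) u : (forall i j : 'I_n.+2, (i < j)%N -> d (z i) (z j) `^ p = W) ->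
    \sum_(i < n.+2) \sum_(j < n.+2 | (i < j)%N) u i * u j * d (z i) (z j) `^ p =
    ((\sum_i u i) ^+ 2 - \sum_i u i ^+ 2) / 2 * W.
  move=> dzz; rewrite -sum_lt_pairs mulr_suml; apply: eq_bigr => i _.
  by rewrite mulr_suml; apply: eq_bigr => j ij; rewrite dzz.
rewrite (pairs x w dxx) (pairs y (fun=> 1) dyy) sumw sumw2.
rewrite expr1n sumr_const card_ord -/N.
lra.
Qed.

End TwoCliques.

(** * Distances between involutions *)

Section InvolutionDistances.
Variable R : realType.

(** If two members were equal, the trace of their product would be m. *)
Lemma involution_family_inj m n s (g : nat -> 'M[R]_m) i j :
  (0 < m)%N -> symmetric_involution_family n s g -> (i < n)%N -> (j < n)%N ->
  g i = g j -> i = j.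
Proof.
move=> m0 [_ g2 _ gtr].
wlog ij : i j / (i < j)%N => [wl|] ilt jlt gij.
  by have [ij|ij|//] := ltngtP i j; [|symmetry]; apply: wl.
have := gtr i j; rewrite ij jlt gij g2 // mxtrace1 => /(_ isT)/eqP.
by rewrite pnatr_eq0 -leqn0 leqNgt m0.
Qed.

Lemma schatten_enorm_involution m (A : 'M[R]_m) q : (0 < q)%E -> (0 < m)%N ->
  A^T = A -> A *m A = 1%:M -> schatten_enorm q (mxop A) = (m%:R `^ exponent_inv q)%:E.
Proof.
move=> q0 m0 AT A2; rewrite (@schatten_enorm_mxop _ _ _ _ 1 m) ?mulr1 //.
by exists 1%:M, 1%:M; rewrite A2 expr1n scale1r !mulmx1.
Qed.

(** Anticommuting members give the singular value 2^(1/2) with multiplicity m;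
    commuting members give 2 with multiplicity m / 2. In both cases the factor
    m^(1/q) splits off, and what remains does not depend on m. *)
Lemma schatten_enorm_sub_involutions m n s (g : nat -> 'M[R]_m) q i j :
  (0 < q)%E -> (0 < m)%N -> symmetric_involution_family n s g -> (i < j < n)%N ->
  schatten_enorm q (mxop (g i) - mxop (g j)) =
  (m%:R `^ exponent_inv q *
   2 `^ (if s i j then 2^-1 else 1 - exponent_inv q))%:E.
Proof.
move=> q0 m0 [gT g2 gC gtr] ijn; have /andP[ij jn] := ijn.
have iN := ltn_trans ij jn.
have symB : (g i - g j)^T = g i - g j by rewrite linearB /= !gT.
rewrite mxopB; case sij: (s i j).
  rewrite powR12_sqrt // (@schatten_enorm_mxop _ _ _ _ (Num.sqrt 2) m) //.
  rewrite sqr_sqrtr //; apply: sub_anticommuting_involutions; rewrite ?g2 //.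
  by rewrite gC // sij expr1 scaleN1r.
have comm : g i *m g j = g j *m g i by rewrite gC // sij expr0 scale1r.
have [r mE sqB] := sub_commuting_involutions (g2 _ iN) (g2 _ jn) comm (gtr _ _ ijn).
have r0 : (0 < r)%N by rewrite -double_gt0 -mE.
rewrite (@schatten_enorm_mxop _ _ _ _ 2 r) //; last first.
  by rewrite (_ : 2 ^+ 2 = 4) // -natrX.
rewrite [in RHS]mE -muln2 natrM powRM // -mulrA -powRD ?pnatr_eq0 ?implybT //.
by rewrite subrKC powRr1.
Qed.

End InvolutionDistances.

(** * Existence of a polygonal equality *)

Lemma exists_nat_succ_mul_le (R : realType) (x y : R) : x < y ->
  exists n : nat, n.+2%:R * x <= n.+1%:R * y.
Proof.
move=> xy; have d0 : 0 < y - x by rewrite subr_gt0.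
(* The claim reads x <= (n + 1) (y - x). *)
exists (Num.truncn (`|x| / (y - x))).
have := truncnS_gt (`|x| / (y - x)); rewrite ltr_pdivrMr //.
set n := Num.truncn _ => h; have := ler_norm x.
rewrite -[n.+2%:R]natr1; lra.
Qed.

Lemma exponent_inv_half (R : realType) (q : \bar R) :
  exponent_inv q = 2^-1 -> q = 2%:E.
Proof.
case: q => [t /= /invr_inj -> //| |] /= /esym/eqP; by rewrite invr_eq0 pnatr_eq0.
Qed.

Theorem mainTheorem3 (R : realType) (q : \bar R)
  (hq0 : (0 < q)%E) (hq2 : q <> (2 : R)%:E) (p : R) (hp : (0 < p)%R) :
  exists Q : signed_simplex R (schatten_class q),
    nontrivial_polygonal_equality (@schatten_dist R q) p Q.
Proof.
set e := exponent_inv q.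
(* b holds when q > 2, and f c is the exponent of 2 in the norm of a difference
   of two involutions that anticommute (c = true) or commute (c = false). *)
pose b := e < 2^-1.
pose f c := if c then 2^-1 else 1 - e.
have fb : f b < f (~~ b).
  rewrite /f /b; case: (ltgtP e 2^-1) => [e2|e2|/exponent_inv_half //] /=; lra.
(* The distance is the norm raised to the power 1 or q. *)
pose P := (if (1 <= q)%E then 1 else fine q) * p.
have P0 : 0 < P.
  rewrite mulr_gt0 //; case: ifPn => // q1.
  case: q hq0 q1 {hq2 e b f fb P} => [t| |] //=; rewrite ?lte_fin //.
  by rewrite leey.
have lt_powers : (2 `^ f b) `^ P < (2 `^ f (~~ b)) `^ P.
  rewrite gt0_ltr_powR ?nnegrE ?powR_ge0 // /powR pnatr_eq0 /= ltr_expR.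
  by rewrite ltr_pM2r ?ln_gt0 ?ltr1n.
have [n nP] := exists_nat_succ_mul_le lt_powers.
pose N := n.+2.
(* For q > 2, commute within each half and anticommute across; for q < 2, the
   reverse. *)
pose s i j := ((i < N)%N == (j < N)%N) (+) b.
have [m [m0 [g gP]]] := exists_symmetric_involution_family R (N + N) s.
have g_class (k : 'I_(N + N)) : mxop (g k) \in schatten_class q.
  have [gT g2 _ _] := gP; apply: mxop_schatten_class.
  by rewrite schatten_enorm_involution ?gT ?g2 ?ltry.
pose pt k : schatten_class q := SigSub (g_class k).
have pt_inj : injective pt.
  move=> k l /(congr1 val) /= /mxop_inj gkl; apply: val_inj.
  exact: involution_family_inj m0 gP (ltn_ord k) (ltn_ord l) gkl.
pose mu := (m%:R `^ e) `^ P.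
have mu0 : 0 < mu by rewrite !powR_gt0 // ltr0n.
have dist_pt (k l : 'I_(N + N)) : (k < l)%N ->
    schatten_dist (pt k) (pt l) `^ p = mu * (2 `^ f (s k l)) `^ P.
  move=> kl; have kln : (k < l < N + N)%N by rewrite kl ltn_ord.
  rewrite /schatten_dist /schatten_norm /=.
  rewrite (schatten_enorm_sub_involutions hq0 m0 gP kln) /= -/e -/(f _).
  rewrite -powRM ?powR_ge0 // /P powRrM; case: ifP => // _.
  by rewrite powRr1 // mulr_ge0 ?powR_ge0.
apply: (@two_cliques_polygonal_equality _ _ _ _ n (pt \o @lshift N N)
  (pt \o @rshift N N) (mu * (2 `^ f b) `^ P) (mu * (2 `^ f (~~ b)) `^ P)).
- have pow_gt0 : 0 < (2 `^ f (~~ b)) `^ P by apply: powR_gt0; exact: powR_gt0.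
  exact: (mulr_gt0 mu0 pow_gt0).
- by rewrite !(mulrCA _ mu) ler_pM2l.
- move=> i j; rewrite dist_pt /=; last exact: ltn_addr.
  by rewrite /s ltn_ord ltnNge leq_addr.
- move=> i j ij; rewrite dist_pt; last exact: ij.
  by rewrite /s /= (ltn_ord i) (ltn_ord j).
- move=> i j ij; rewrite dist_pt; last by rewrite /= ltn_add2l.
  by rewrite /s /= ![(N + _ < N)%N]ltnNge !leq_addr.
- by move=> i j /pt_inj/rshift_inj.
- by move=> i j; rewrite /= (inj_eq pt_inj) eq_lrshift.
Qed.
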